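(* Let $n$ be a positive integer and let $A\subseteq[2]^n$ have equal-slices density $\delta$. Then the set $L(A)=\{y\in[3]^n: y^{3\rightarrow1}\in A \text{ and } y^{3\rightarrow 2}\in A\}$ of (possibly degenerate) combinatorial lines in $A$ has equal-slices measure (in $[3]^n$) at least $\delta^2(n+1)/(n+2)$.
   Context: $[k]=\{1,\dots,k\}$. The equal-slices measure on $[k]^n$: choose, uniformly among all possibilities, a $k$-tuple $(a_1,\dots,a_k)$ of non-negative integers with sum $n$, then choose $x\in[k]^n$ uniformly among the sequences with $|\{i:x_i=j\}|=a_j$ for all $j$. For $y\in[k+1]^n$ and $j\in[k]$, $y^{k+1\rightarrow j}$ denotes the sequence obtained by replacing every coordinate equal to $k+1$ by $j$. A point $y\in[k+1]^n$ is identified with the (possibly degenerate, i.e. with empty wildcard set) combinatorial line $\{y^{k+1\rightarrow j}:j\in[k]\}$ of $[k]^n$, whose wildcard set is $\{i:y_i=k+1\}$; the equal-slices density of a set of lines is the equal-slices measure of the corresponding set of points of $[k+1]^n$. *)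

(* Defs.v *)
From mathcomp Require Import all_boot all_order all_algebra.

Set Implicit Arguments.
Unset Strict Implicit.
Unset Printing Implicit Defensive.

Import Order.TTheory GRing.Theory Num.Theory.
Local Open Scope ring_scope.

(* The point space [k]^n. The letter j of [k] = {1, ..., k} is the ordinal of
   value j - 1; in particular the wildcard letter k+1 of [k+1] is
   ord_max : 'I_k.+1. *)
Definition word (k n : nat) := {ffun 'I_n -> 'I_k}.

(* The k-tuples of non-negative integers with sum n; every entry of such a
   tuple is at most n, so it lies in 'I_n.+1. *)
Definition compositions (k n : nat) : {set {ffun 'I_k -> 'I_n.+1}} :=
  [set a : {ffun 'I_k -> 'I_n.+1} | (\sum_(j < k) a j)%N == n].

Definition slice (k n : nat) (a : {ffun 'I_k -> 'I_n.+1}) : {set word k n} :=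
  [set x : word k n | [forall j, #|[set i | x i == j]| == a j]].

(* Probability that x lies in A, when a is uniform among the compositions and
   then x is uniform in the slice of a (which is never empty). *)
Definition equal_slices (R : realFieldType) (k n : nat) (A : {set word k n}) : R :=
  (\sum_(a in compositions k n) #|A :&: slice a|%:R / #|slice a|%:R)
    / #|compositions k n|%:R.

(* y^{k+1 -> j}: [unlift ord_max c] is [None] if c is the wildcard letter, and
   otherwise [Some] of the letter of [k] with the same value as c. *)
Definition subst_wildcard (k n : nat) (y : word k.+1 n) (j : 'I_k) : word k n :=
  [ffun i => odflt j (unlift ord_max (y i))].

(* L(A), for k = 2: the letters 1 and 2 are ord0 and ord_max in 'I_2. *)
Definition lines_in (n : nat) (A : {set word 2 n}) : {set word 3 n} :=
  [set y : word 3 n |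
    (subst_wildcard y ord0 \in A) && (subst_wildcard y ord_max \in A)].

(* Main.v *)
(** Apply a uniform permutation to the chain of words 1^t 2^(n-t), 0 <= t <= n,
    and let m be the number of its n + 1 members that fall in A.  A slice is an
    orbit of the symmetric group, so delta is the mean of m / (n + 1).  A point
    of [3]^n is a permuted word 1^s 3^(t-s) 2^(n-t), and its line lies in A iff
    the s-th and the t-th members of the permuted chain do; hence the density of
    L(A) is the mean of m (m + 1) / ((n + 1) (n + 2)), and the claim follows
    from E[m^2] >= E[m]^2. *)
Require Import Defs.
From mathcomp Require Import all_boot all_order all_algebra all_fingroup.
From mathcomp Require Import zify ring lra.
Import Order.TTheory GRing.Theory Num.Theory.
Local Open Scope ring_scope.

(** * Slices as orbits of the symmetric group *)

Definition profile {k n : nat} (x : word k n) : {ffun 'I_k -> 'I_n.+1} :=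
  [ffun j => inord #|[set i | x i == j]|].

Definition permute_word {k n : nat} (x : word k n) (p : 'S_n) : word k n :=
  [ffun i => x (p i)].

(** This bound keeps [inord] in [profile] off its default value. *)
Lemma card_letter_lt (k n : nat) (x : word k n) (j : 'I_k) :
  (#|[set i | x i == j]| < n.+1)%N.
Proof. by rewrite ltnS -[X in (_ <= X)%N](card_ord n) max_card. Qed.

Lemma profileE (k n : nat) (x : word k n) (j : 'I_k) :
  profile x j = #|[set i | x i == j]| :> nat.
Proof. by rewrite ffunE inordK // card_letter_lt. Qed.

Lemma mem_slice (k n : nat) (x : word k n) (a : {ffun 'I_k -> 'I_n.+1}) :
  (x \in slice a) = (profile x == a).
Proof.
rewrite inE; apply/forallP/eqP => [xa | <- j]; last by rewrite profileE.
by apply/ffunP => j; apply: val_inj; rewrite /= profileE; apply/eqP.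
Qed.

Lemma sum_card_letter (k n : nat) (x : word k n) :
  (\sum_(j < k) #|[set i | x i == j]|)%N = n.
Proof.
rewrite -[RHS](card_ord n) -[RHS]sum1_card.
rewrite (partition_big x predT) //=; apply: eq_bigr => j _.
by rewrite -sum1_card; apply: eq_bigl => i; rewrite inE.
Qed.

Lemma profile_in_compositions (k n : nat) (x : word k n) :
  profile x \in compositions k n.
Proof.
rewrite inE -[X in _ == X](sum_card_letter k n x); apply/eqP.
by apply: eq_bigr => j _; rewrite profileE.
Qed.

Lemma profile_permute (k n : nat) (x : word k n) (p : 'S_n) :
  profile (permute_word x p) = profile x.
Proof.
apply/ffunP => j; apply: val_inj; rewrite /= !profileE.
rewrite -(card_imset [set i | permute_word x p i == j] (@perm_inj _ p)).
congr #|pred_of_set _|; apply/setP => i; rewrite inE.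
apply/imsetP/idP => [[i' + ->] | xi]; first by rewrite inE ffunE.
by exists ((p^-1)%g i); rewrite ?permKV // inE ffunE permKV.
Qed.

Lemma permute_wordM (k n : nat) (x : word k n) (p q : 'S_n) :
  permute_word (permute_word x p) q = permute_word x (q * p)%g.
Proof. by apply/ffunP => i; rewrite !ffunE permM. Qed.

(** Words read as sequences are rearrangements of each other once every letter has the same count in
    both, which makes the symmetric group transitive on each slice. *)
Lemma profile_eq_permute (k n : nat) (x y : word k n) :
  profile x = profile y -> exists p : 'S_n, permute_word x p = y.
Proof.
move=> exy.
have cnt (z : word k n) j : count_mem j [tuple z i | i < n] = profile z j.
  rewrite profileE /= count_map cardE -size_filter enumT.
  by congr size; apply: eq_filter => i; rewrite /= inE.
have /tuple_permP [p Ep] : perm_eq [tuple y i | i < n] [tuple x i | i < n].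
  by apply/allP => j _ /=; rewrite !cnt exy.
exists p; apply/ffunP => i; rewrite ffunE.
have /val_inj /(congr1 (fun t => tnth t i)) := Ep.
by rewrite !tnth_mktuple.
Qed.

(* By transitivity, the permutations taking [x] to a given word of its slice
   form a coset of the stabiliser of [x]. *)
Lemma card_permute_slice (k n : nat) (x : word k n) (B : {set word k n}) :
  (#|[set p | permute_word x p \in B]| * #|slice (profile x)| =
   #|B :&: slice (profile x)| * n`!)%N.
Proof.
set S := slice _; pose c := #|[set p | permute_word x p == x]|.
have fiber y : y \in S -> #|[set p | permute_word x p == y]| = c.
  rewrite mem_slice => /eqP /esym /profile_eq_permute [q <-].
  rewrite /c -[RHS](card_imset _ (mulgI q)); congr #|pred_of_set _|.
  apply/setP => p; rewrite inE.
  apply/eqP/imsetP => [Ep | [r]].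
    exists (q^-1 * p)%g; rewrite ?mulKVg // inE -permute_wordM Ep.
    by rewrite permute_wordM mulVg; apply/eqP/ffunP => i; rewrite ffunE perm1.
  by rewrite inE => /eqP Er ->; rewrite -permute_wordM Er.
have total (C : {set word k n}) :
    #|[set p | permute_word x p \in C]| = (#|C :&: S| * c)%N.
  rewrite -sum1_card (partition_big (permute_word x) (mem (C :&: S))) /=.
    rewrite -sum_nat_const; apply: eq_bigr => y /setIP [yC yS].
    rewrite -(fiber y yS) -sum1_card; apply: eq_bigl => p; rewrite !inE.
    by case: eqP => [->|]; rewrite ?yC ?andbF.
  by move=> p; rewrite inE in_setI mem_slice profile_permute eqxx => ->.
(* With all words allowed, [total] becomes the orbit-stabiliser count, which eliminates [c]. *)
have := total setT; rewrite setTI => cT.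
have -> : n`! = (#|S| * c)%N.
  by rewrite -cT -card_Sn; apply: eq_card => p; rewrite !inE.
by rewrite total; lia.
Qed.

(** A uniformly permuted word is uniform in its slice, so one representative [w i] per slice
    suffices. Exchanging the averages over [i] and [p] leaves, for each [p], a count of permuted
    representatives in [A]. *)
Lemma equal_slices_permute (R : realFieldType) (k n : nat) (I : finType)
    (P : {set I}) (w : I -> word k n) (A : {set word k n}) :
    {in P &, injective (fun i => profile (w i))} ->
    (forall a, a \in compositions k n ->
       exists2 i, i \in P & profile (w i) = a) ->
  equal_slices R A =
    (\sum_(p : 'S_n) #|[set i in P | permute_word (w i) p \in A]|%:R)
      / (n`!%:R * #|P|%:R).
Proof.
move=> w_inj w_onto; rewrite /equal_slices.
have -> : compositions k n = [set profile (w i) | i in P].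
  apply/setP => a; apply/idP/imsetP => [/w_onto [i iP <-] | [i _ ->]].
    by exists i.
  exact: profile_in_compositions.
rewrite big_imset //= card_in_imset // invfM mulrA; congr (_ / _).
under eq_bigr => i _.
  have S_neq0 : #|slice (profile (w i))|%:R != 0 :> R.
    rewrite pnatr_eq0 -lt0n; apply/card_gt0P.
    by exists (w i); rewrite mem_slice.
  have F_neq0 : n`!%:R != 0 :> R by rewrite pnatr_eq0 -lt0n fact_gt0.
  have -> : #|A :&: slice (profile (w i))|%:R
              / #|slice (profile (w i))|%:R
      = #|[set p | permute_word (w i) p \in A]|%:R / n`!%:R :> R.
    apply/eqP; rewrite eqr_div //; apply/eqP.
    by rewrite -!natrM card_permute_slice.
  over.
rewrite -big_distrl /=; congr (_ / _); rewrite -!natr_sum; congr (_%:R).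
under eq_bigr do rewrite cardsE -sum1_card.
rewrite (exchange_big_dep predT) //=; apply: eq_bigr => p _.
by rewrite -sum1_card; apply: eq_bigl => i; rewrite !inE.
Qed.

(** * Chains that meet every slice once *)

Lemma card_ord_lt (n t : nat) : (t <= n)%N -> #|[set i : 'I_n | (i < t)%N]| = t.
Proof.
move=> le_tn; rewrite cardsE -sum1_card.
by rewrite -(big_ord_widen n (fun=> 1%N) le_tn) sum1_card card_ord.
Qed.

Definition chain2 {n : nat} (t : 'I_n.+1) : word 2 n :=
  [ffun i : 'I_n => if (i < t)%N then ord0 else ord_max].

(* The letters 1, 2 and 3 are [lift ord_max ord0], [lift ord_max ord_max] and
   [ord_max]; this form lets [unlift ord_max] reduce. *)
Definition chain3 {n : nat} (u : 'I_n.+1 * 'I_n.+1) : word 3 n :=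
  [ffun i : 'I_n => if (i < u.1)%N then lift ord_max ord0
                    else if (i < u.2)%N then ord_max else lift ord_max ord_max].

Definition ordered_pairs {n : nat} (Q : {set 'I_n}) : {set 'I_n * 'I_n} :=
  [set u : 'I_n * 'I_n | [&& (u.1 <= u.2)%N, u.1 \in Q & u.2 \in Q]].

Lemma profile_chain2 (n : nat) (t : 'I_n.+1) :
  profile (chain2 t) ord0 = t.
Proof.
apply: val_inj; rewrite /= profileE -[RHS](card_ord_lt n t) -1?ltnS //.
congr #|pred_of_set _|; apply/setP => i; rewrite !inE ffunE.
by case: ifP.
Qed.

Lemma profile_chain3 (n : nat) (u : 'I_n.+1 * 'I_n.+1) : (u.1 <= u.2)%N ->
  profile (chain3 u) (lift ord_max ord0) = u.1 /\
  profile (chain3 u) ord_max = (u.2 - u.1)%N :> nat.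
Proof.
case: u => s t /= le_st; have le_tn : (t <= n)%N by rewrite -ltnS.
have le_sn := leq_trans le_st le_tn; split; first apply: val_inj;
    rewrite /= profileE.
  rewrite -[RHS](card_ord_lt n s) //.
  congr #|pred_of_set _|; apply/setP => i; rewrite !inE ffunE /=.
  by case: ifP => // _; case: ifP.
rewrite -[in RHS](card_ord_lt n t) // -[in RHS](card_ord_lt n s) //.
rewrite -[in RHS](setIidPr (_ : [set i : 'I_n | (i < s)%N]
                              \subset [set i : 'I_n | (i < t)%N])).
  rewrite -cardsD; congr #|pred_of_set _|; apply/setP => i.
  by rewrite !inE ffunE /=; do 2?case: ifP.
by apply/subsetP => i; rewrite !inE => /leq_trans; apply.
Qed.

(** The prescribed sum determines the remaining entry, so below one letter count never has to be
    computed. *)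
Lemma compositions_eq (k n : nat) (j0 : 'I_k) (a b : {ffun 'I_k -> 'I_n.+1}) :
    a \in compositions k n -> b \in compositions k n ->
  (forall j, j != j0 -> a j = b j) -> a = b.
Proof.
rewrite !inE => /eqP sa /eqP sb eq_ab; apply/ffunP => j.
have [-> | /eq_ab //] := eqVneq j j0; apply: val_inj => /=.
move: sb; rewrite -[RHS]sa (bigD1 j0) //= [in RHS](bigD1 j0) //=.
by rewrite [X in _ = (_ + X)%N](eq_bigr (val \o b)) => [/addIn | i /eq_ab ->].
Qed.

Lemma chain2_transversal (n : nat) (a : {ffun 'I_2 -> 'I_n.+1}) :
  a \in compositions 2 n -> profile (chain2 (a ord0)) = a.
Proof.
move=> aP; apply: (compositions_eq 2 n ord_max) => //.
  exact: profile_in_compositions.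
move=> j; case: (unliftP ord_max j) => [j' -> _ | ->]; last by rewrite eqxx.
have -> : lift ord_max j' = ord0 by apply: val_inj; rewrite /= ord1.
exact: profile_chain2.
Qed.

Lemma chain3_transversal (n : nat) (a : {ffun 'I_3 -> 'I_n.+1}) :
  a \in compositions 3 n ->
  exists2 u, u \in ordered_pairs [set: 'I_n.+1] & profile (chain3 u) = a.
Proof.
(* The block of 1s has length [s] and the wildcard block after it has length [d], so the latter ends
   at [s + d]. *)
move=> aP; set s := a (lift ord_max ord0); set d := a ord_max.
have lt_sd : (s + d < n.+1)%N.
  move: aP; rewrite inE (bigD1 ord_max) //= (bigD1 (lift ord_max ord0)) //=.
  by rewrite -/s -/d => /eqP; lia.
pose u := (s, Ordinal lt_sd); have le_u : (u.1 <= u.2)%N by rewrite leq_addr.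
exists u; first by rewrite !inE le_u.
have [E0 E2] := profile_chain3 n u le_u.
apply: (compositions_eq 3 n (lift ord_max ord_max)) => //.
  exact: profile_in_compositions.
move=> j; case: (unliftP ord_max j) => [j' -> | -> _].
  case: (unliftP ord_max j') => [j'' -> _ | ->]; last by rewrite eqxx.
  by have -> : lift ord_max j'' = ord0 by apply: val_inj; rewrite /= ord1.
by apply: val_inj; rewrite /= E2 /= addKn.
Qed.

Lemma chain3_inj (n : nat) :
  {in ordered_pairs [set: 'I_n.+1] &, injective (fun u => profile (chain3 u))}.
Proof.
move=> [s t] [s' t']; rewrite !inE !andbT /= => le_st le_st' E.
have [E0 E2] := profile_chain3 n (s, t) le_st.
have [E0' E2'] := profile_chain3 n (s', t') le_st'.
move: E0 E2; rewrite E E0' E2' /= => Es Et.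
rewrite -Es in le_st Et *; congr (_, _); apply: val_inj => /=.
(* Since [s <= t], the subtraction is not truncated and [t] is recovered from [t - s]. *)
by rewrite -(subnKC le_st) -Et subnKC.
Qed.

(** * Lines along a chain, and their number *)

Lemma permute_subst_wildcard (k n : nat) (y : word k.+1 n) (p : 'S_n) (j : 'I_k) :
  subst_wildcard (permute_word y p) j =
  permute_word (subst_wildcard y j) p.
Proof. by apply/ffunP => i; rewrite !ffunE. Qed.

(** The indices cross over: turning the wildcards into 1s prolongs the initial block of 1s up to
    [u.2], while turning them into 2s leaves it ending at [u.1]. *)
Lemma subst_chain3 (n : nat) (u : 'I_n.+1 * 'I_n.+1) : (u.1 <= u.2)%N ->
  subst_wildcard (chain3 u) ord0 = chain2 u.2 /\
  subst_wildcard (chain3 u) ord_max = chain2 u.1.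
Proof.
move=> le_u; split; apply/ffunP => i; rewrite !ffunE.
  case: ifP => [/leq_trans/(_ le_u) -> | _]; first by rewrite liftK.
  by case: ifP => _; rewrite ?liftK ?unlift_none.
by case: ifP => _; last case: ifP => _; rewrite ?liftK ?unlift_none.
Qed.

(** These pairs and their mirror images cover the square of [Q] and overlap exactly in the diagonal;
    inclusion-exclusion does the rest. *)
Lemma card_ordered_pairs (n : nat) (Q : {set 'I_n}) :
  (#|ordered_pairs Q|.*2 = #|Q| * #|Q|.+1)%N.
Proof.
pose sw (u : 'I_n * 'I_n) := (u.2, u.1).
have swK : involutive sw by case.
have card_sw : #|sw @: ordered_pairs Q| = #|ordered_pairs Q|.
  exact/card_imset/(inv_inj swK).
have mem_sw s t : ((s, t) \in sw @: ordered_pairs Q) = ((t, s) \in ordered_pairs Q).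
  exact: (mem_imset _ (t, s) (inv_inj swK)).
have U : ordered_pairs Q :|: sw @: ordered_pairs Q = setX Q Q.
  apply/setP => -[s t]; rewrite in_setU in_setX mem_sw !inE /=.
  by case: leqP => [|/ltnW ->]; case: (s \in Q); case: (t \in Q);
    rewrite ?andbF.
have D : ordered_pairs Q :&: sw @: ordered_pairs Q = [set (i, i) | i in Q].
  apply/setP => -[s t]; rewrite in_setI mem_sw !inE /=.
  apply/idP/imsetP => [/andP [/and3P [st sQ _] /andP [ts _]] | [i iQ [-> ->]]].
    by exists s => //; congr (_, _); apply/val_inj/anti_leq; rewrite ts.
  by rewrite leqnn iQ.
have := cardsUI (ordered_pairs Q) (sw @: ordered_pairs Q).
rewrite U D cardsX card_imset => [|i j []] //.
by rewrite card_sw addnn mulnS addnC => ->.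
Qed.

(** Nonnegativity of the variance, with deviations scaled by [N] to avoid division. Cancelling [N]
    at the end requires [0 < N], hence the separate empty case. *)
Lemma sqr_sum_le_card_sum_sqr (R : realFieldType) (I : finType) (f : I -> R) :
  (\sum_i f i) ^+ 2 <= #|I|%:R * \sum_i f i ^+ 2.
Proof.
set M := \sum_i f i; set N : R := #|I|%:R.
have [I0 | I_gt0] := posnP #|I|.
  rewrite /M big1 ?expr0n ?mulr_ge0 ?sumr_ge0 ?ler0n // => [i _|i _].
    exact: sqr_ge0.
  by have := card0_eq I0 i; rewrite inE.
have N_gt0 : 0 < N by rewrite ltr0n.
have : 0 <= \sum_i (N * f i - M) ^+ 2 by apply: sumr_ge0 => i _; exact: sqr_ge0.
have -> : \sum_i (N * f i - M) ^+ 2 = N * (N * (\sum_i f i ^+ 2) - M ^+ 2).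
  under eq_bigr => i _.
    have -> : (N * f i - M) ^+ 2 = N ^+ 2 * f i ^+ 2 - N * M *+ 2 * f i + M ^+ 2.
      by ring.
    over.
  rewrite big_split sumrB /= sumr_const -!big_distrr /= -/M.
  by rewrite -[M ^+ 2 *+ _]mulr_natl -/N; ring.
by rewrite pmulr_rge0 // subr_ge0.
Qed.

Theorem theorem3p1 (R : realFieldType) (n : nat) (n_gt0 : (0 < n)%N)
    (A : {set word 2 n}) (delta : R) (A_density : equal_slices R A = delta) :
  delta ^+ 2 * (n%:R + 1) / (n%:R + 2) <= equal_slices R (lines_in A).
Proof.
pose Q (p : 'S_n) := [set t | permute_word (chain2 t) p \in A].
have <- : (\sum_p #|Q p|%:R) / (n`!%:R * (n%:R + 1)) = delta.
  rewrite -A_density (equal_slices_permute R 2 n _ setT chain2).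
  - rewrite cardsT card_ord natr1; congr (_ / _); apply: eq_bigr => p _.
    by congr (_%:R); apply: eq_card => t; rewrite !inE.
  - move=> s t _ _ /(congr1 (fun a : {ffun _} => a ord0)).
    by rewrite !profile_chain2.
  - by move=> a /chain2_transversal; exists (a ord0).
rewrite (equal_slices_permute R 3 n _ _ chain3 _ (chain3_inj n)
  (chain3_transversal n)).
(* Used both for [Q p] and for the full index set, where it counts the slices of [3]^n. *)
have half (N : {set 'I_n.+1}) :
    #|ordered_pairs N|%:R = #|N|%:R * (#|N|%:R + 1) / 2 :> R.
  apply: (mulIf (_ : 2 != 0)); first by rewrite pnatr_eq0.
  rewrite divfK ?pnatr_eq0 // natr1 -!natrM -card_ordered_pairs.
  by rewrite muln2.
under [X in _ <= X / _]eq_bigr => p _.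
  have -> : [set u in ordered_pairs [set: 'I_n.+1]
              | permute_word (chain3 u) p \in lines_in A]
          = ordered_pairs (Q p).
    apply/setP => u; rewrite !inE !permute_subst_wildcard andbT.
    by case: leqP => //= /subst_chain3 [-> ->]; rewrite andbC.
  rewrite half; over.
rewrite half cardsT card_ord -[n.+1%:R]natr1 -big_distrl /=.
set M := \sum_p _; set S := \sum_p _.
(* With m the size of [Q p], [S] sums m (m + 1); bounding this below by m^2 reduces the claim to the
   variance inequality. *)
have le_MS : M ^+ 2 <= n`!%:R * S.
  have := sqr_sum_le_card_sum_sqr R 'S_n (fun p => #|Q p|%:R).
  rewrite card_Sn => /le_trans; apply; rewrite ler_pM2l ?ltr0n ?fact_gt0 //.
  by apply: ler_sum => p _; rewrite mulrDr mulr1 lerDl.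
have F_gt0 : 0 < n`!%:R :> R by rewrite ltr0n fact_gt0.
have n_ge0 : 0 <= n%:R :> R by rewrite ler0n.
move: n`!%:R n%:R F_gt0 n_ge0 le_MS => F x F_gt0 x_ge0 le_MS.
(* Both sides are put over one denominator, so that [le_MS] compares the numerators. *)
have -> : (M / (F * (x + 1))) ^+ 2 * (x + 1) / (x + 2)
        = M ^+ 2 / (F ^+ 2 * (x + 1) * (x + 2)).
  by field; apply/and3P; split; apply: lt0r_neq0; lra.
have -> : S / 2 / (F * ((x + 1) * (x + 1 + 1) / 2))
        = F * S / (F ^+ 2 * (x + 1) * (x + 2)).
  by field; apply/and3P; split; apply: lt0r_neq0; lra.
apply: ler_wpM2r => //; rewrite invr_ge0 !mulr_ge0 ?exprn_ge0 //; lra.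
Qed.
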